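(* Let $f:\mathbb{R}^n\to\mathbb{R}$ be continuously differentiable on $\mathbb{R}^n$, let $m\ge1$ be an integer, let $\epsilon>0$ and $M>0$ be constants, and let $0<c_1<c_2<1$. Suppose the Two-Sided L-BFGS algorithm, with memory depth $m$ and envelope parameters $\epsilon,M$, generates from $x_0\in\mathbb{R}^n$ an infinite sequence of iterates $\{x_k\}_{k=0}^\infty$, $x_{k+1}=x_k+\alpha_kp_k$, with step lengths $\alpha_k>0$ satisfying the strong Wolfe conditions $$f(x_k+\alpha_kp_k)\le f(x_k)+c_1\alpha_k\nabla f(x_k)^Tp_k,\qquad |\nabla f(x_k+\alpha_kp_k)^Tp_k|\le c_2|\nabla f(x_k)^Tp_k|$$ for all $k\ge0$, where a pair $(s_k,y_k)$ is accepted into the memory buffer if and only if $$\frac{y_k^Ts_k}{\|s_k\|^2}\ge\epsilon\quad\text{and}\quad\frac{\|y_k\|^2}{y_k^Ts_k}\le M.$$ Assume that: 1. the initial level set $\Omega=\{x\in\mathbb{R}^n\mid f(x)\le f(x_0)\}$ is bounded; 2. the gradient $\nabla f$ is $\beta$-Lipschitz continuous on $\Omega$ for some $\beta>0$, i.e. $\|\nabla f(x)-\nabla f(y)\|\le\beta\|x-y\|$ for all $x,y\in\Omega$. Then $$\lim_{k\to\infty}\|\nabla f(x_k)\|=0.$$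
   Context: Norms are Euclidean. Two-Sided L-BFGS algorithm. Inputs: starting point $x_0\in\mathbb{R}^n$, memory depth $m\ge1$, envelope parameters $\epsilon,M$, line-search constants $0<c_1<c_2<1$, and $\gamma_0=1$. The algorithm keeps a memory buffer (a queue, initially empty) of at most $m$ pairs of vectors $(s,y)\in\mathbb{R}^n\times\mathbb{R}^n$. For $k=0,1,2,\dots$, as long as $\nabla f(x_k)\ne0$ (so an infinite sequence of iterates means $\nabla f(x_k)\neq 0$ for all $k$): 1. Let $(s_1,y_1),\dots,(s_{\hat m},y_{\hat m})$, $\hat m\le m$, be the pairs currently in the buffer, ordered from oldest to newest (positions in the buffer, not iteration indices). The matrix $H_k$ is defined by $H_k:=H_k^{(\hat m)}$, where $H_k^{(0)}=\gamma_k I$ and, for $1\le j\le\hat m$, $$H_k^{(j)}=(I-\rho_j s_jy_j^T)H_k^{(j-1)}(I-\rho_j y_js_j^T)+\rho_j s_js_j^T,\qquad \rho_j=\frac{1}{y_j^Ts_j}.$$ The search direction is $p_k=-H_k\nabla f(x_k)$. 2. Choose a step length $\alpha_k>0$ satisfying the strong Wolfe conditions, and set $x_{k+1}=x_k+\alpha_kp_k$. 3. Set $s_k=x_{k+1}-x_k$ and $y_k=\nabla f(x_{k+1})-\nabla f(x_k)$. If $\frac{y_k^Ts_k}{\|s_k\|^2}\ge\epsilon$ and $\frac{\|y_k\|^2}{y_k^Ts_k}\le M$, then (after removing the oldest pair if the buffer already holds $m$ pairs) append $(s_k,y_k)$ to the buffer and set $\gamma_{k+1}=\frac{s_k^Ty_k}{\|y_k\|^2}$.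 Otherwise leave the buffer unchanged and set $\gamma_{k+1}=\gamma_k$. *)

(* Defs.v *)
From HB Require Import structures.
From mathcomp Require Import all_boot all_order all_algebra.
From mathcomp Require Import all_classical all_reals all_analysis.

Set Implicit Arguments.
Unset Strict Implicit.
Unset Printing Implicit Defensive.

Import Order.TTheory GRing.Theory Num.Theory.
Import numFieldNormedType.Exports.

Local Open Scope classical_set_scope.
Local Open Scope ring_scope.

Definition dot (R : realType) (n : nat) (u v : 'cV[R]_n) : R :=
  (u^T *m v) ord0 ord0.

(* The library norm on matrices is the sup norm, hence this definition. Both
   norms induce the same topology, so [continuous] and [differentiable] on
   ['cV[R]_n] have their usual meaning on R^n. *)
Definition enorm (R : realType) (n : nat) (u : 'cV[R]_n) : R :=
  Num.sqrt (dot u u).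

Definition grad (R : realType) (n : nat) (f : 'cV[R]_n -> R) (x : 'cV[R]_n) :
    'cV[R]_n :=
  \col_(i < n) 'D_(delta_mx i ord0) f x.

Definition C1 (R : realType) (n : nat) (f : 'cV[R]_n -> R) : Prop :=
  (forall x, differentiable f x) /\ continuous (grad f).

Definition level_set (R : realType) (n : nat) (f : 'cV[R]_n -> R)
    (x0 : 'cV[R]_n) : set 'cV[R]_n :=
  [set x | f x <= f x0].

Definition ebounded (R : realType) (n : nat) (A : set 'cV[R]_n) : Prop :=
  exists C : R, forall x, A x -> enorm x <= C.

Definition elipschitz_on (R : realType) (n : nat) (A : set 'cV[R]_n) (L : R)
    (g : 'cV[R]_n -> 'cV[R]_n) : Prop :=
  forall x y, A x -> A y -> enorm (g x - g y) <= L * enorm (x - y).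

(* A pair [(s, y)] is a step together with the corresponding change of
   gradient; a buffer lists its pairs from oldest to newest. *)
Definition pair_of (R : realType) (n : nat) : Type :=
  ('cV[R]_n * 'cV[R]_n)%type.

Definition bfgs_update (R : realType) (n : nat) (H : 'M[R]_n)
    (sy : pair_of R n) : 'M[R]_n :=
  let: (s, y) := sy in
  let rho := (dot y s)^-1 in
  (1%:M - rho *: (s *m y^T)) *m H *m (1%:M - rho *: (y *m s^T))
  + rho *: (s *m s^T).

Definition lbfgs_matrix (R : realType) (n : nat) (gamma : R)
    (B : seq (pair_of R n)) : 'M[R]_n :=
  foldl (@bfgs_update R n) gamma%:M B.

(* If [s] or [dot y s] vanishes, a quotient below is 0 by the convention
   [0^-1 = 0]; the first test then fails whenever [0 < eps]. *)
Definition accepted (R : realType) (n : nat) (eps M : R)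
    (sy : pair_of R n) : bool :=
  let: (s, y) := sy in
  (eps <= dot y s / enorm s ^+ 2) && (enorm y ^+ 2 / dot y s <= M).

Definition push (T : Type) (m : nat) (B : seq T) (a : T) : seq T :=
  rcons (if size B == m then behead B else B) a.

Definition strong_wolfe (R : realType) (n : nat) (f : 'cV[R]_n -> R)
    (c1 c2 : R) (x p : 'cV[R]_n) (alpha : R) : Prop :=
  f (x + alpha *: p) <= f x + c1 * alpha * dot (grad f x) p /\
  `|dot (grad f (x + alpha *: p)) p| <= c2 * `|dot (grad f x) p|.

Definition search_dir (R : realType) (n : nat) (f : 'cV[R]_n -> R)
    (x : 'cV[R]_n) (gamma : R) (B : seq (pair_of R n)) : 'cV[R]_n :=
  - (lbfgs_matrix gamma B *m grad f x).

Definition new_pair (R : realType) (n : nat) (f : 'cV[R]_n -> R)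
    (x x' : 'cV[R]_n) : pair_of R n :=
  (x' - x, grad f x' - grad f x).

(* A non-terminating execution: [x], [alpha], [gamma] and [B] are the
   sequences of iterates, step lengths, scalings and buffers, where [gamma k]
   and [B k] are the values in force at the beginning of iteration [k]. *)
Record two_sided_lbfgs (R : realType) (n : nat) (f : 'cV[R]_n -> R)
    (x0 : 'cV[R]_n) (m : nat) (eps M c1 c2 : R)
    (x : nat -> 'cV[R]_n) (alpha gamma : nat -> R)
    (B : nat -> seq (pair_of R n)) : Prop := {
  lbfgs_x0 : x 0%N = x0;
  lbfgs_gamma0 : gamma 0%N = 1;
  lbfgs_B0 : B 0%N = [::];
  lbfgs_grad_neq0 : forall k, grad f (x k) <> 0;
  lbfgs_alpha_gt0 : forall k, 0 < alpha k;
  lbfgs_wolfe : forall k,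
    strong_wolfe f c1 c2 (x k) (search_dir f (x k) (gamma k) (B k)) (alpha k);
  lbfgs_xS : forall k,
    x k.+1 = x k + alpha k *: search_dir f (x k) (gamma k) (B k);
  lbfgs_BS : forall k, let sy := new_pair f (x k) (x k.+1) in
    B k.+1 = if accepted eps M sy then push m (B k) sy else B k;
  lbfgs_gammaS : forall k, let sy := new_pair f (x k) (x k.+1) in
    gamma k.+1 =
      if accepted eps M sy then dot sy.1 sy.2 / enorm sy.2 ^+ 2 else gamma k
}.

(* Main.v *)
(** The acceptance test keeps every buffered pair in the envelope
    [y.s >= eps |s|^2], [|y|^2 <= M y.s]. Each BFGS update with such a pair
    degrades lower and upper bounds on the quadratic form of [H] and on the norm
    of [H v] by fixed factors, and at most [m] updates are applied to a scaling
    [gamma] that lies in a fixed interval, so all the [H_k] satisfy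
    [lam |v|^2 <= v.(H_k v)] and [|H_k v|^2 <= Lam |v|^2] with common constants.
    The curvature condition and the Lipschitz bound between consecutive iterates
    (both in the level set) then bound the step lengths away from 0, so the
    Armijo condition yields [f (x k.+1) <= f (x k) - c |grad f (x k)|^2]. As [f]
    is bounded below on the level set, the decreases tend to 0. *)
Require Import Defs.
From mathcomp Require Import all_boot all_order all_algebra.
From mathcomp Require Import all_classical all_reals all_analysis.
From mathcomp Require Import ring lra.

Import Order.TTheory GRing.Theory Num.Theory.
Import numFieldNormedType.Exports.

Local Open Scope classical_set_scope.
Local Open Scope ring_scope.

(** * Euclidean inner product and norm *)

Section Dot.
Context {R : realType} {n : nat}.
Implicit Types (u v w s y : 'cV[R]_n) (a : R).

Lemma dotE u v : dot u v = \sum_i u i ord0 * v i ord0.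
Proof. by rewrite /dot mxE; apply: eq_bigr => i _; rewrite mxE. Qed.

Lemma dotC u v : dot u v = dot v u.
Proof. by rewrite !dotE; apply: eq_bigr => i _; rewrite mulrC. Qed.

Lemma dotDl u v w : dot (u + v) w = dot u w + dot v w.
Proof. by rewrite /dot linearD mulmxDl mxE. Qed.

Lemma dotZl a u v : dot (a *: u) v = a * dot u v.
Proof. by rewrite /dot linearZ /= -scalemxAl mxE. Qed.

Lemma dotDr u v w : dot w (u + v) = dot w u + dot w v.
Proof. by rewrite !(dotC w) dotDl. Qed.

Lemma dotZr a u v : dot u (a *: v) = a * dot u v.
Proof. by rewrite !(dotC u) dotZl. Qed.

Lemma dotNl u v : dot (- u) v = - dot u v.
Proof. by rewrite -scaleN1r dotZl mulN1r. Qed.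

Lemma dotNr u v : dot u (- v) = - dot u v.
Proof. by rewrite !(dotC u) dotNl. Qed.

Definition dot_bilin := (dotDl, dotDr, dotNl, dotNr, dotZl, dotZr).

Lemma dot_ge0 u : 0 <= dot u u.
Proof. by rewrite dotE sumr_ge0 // => i _; rewrite -expr2 sqr_ge0. Qed.

Lemma dot_eq0 u : (dot u u == 0) = (u == 0).
Proof.
apply/idP/eqP => [|->]; last first.
  by rewrite dotE big1 // => i _; rewrite mxE mul0r.
rewrite dotE psumr_eq0 => [/allP u0|i _]; last by rewrite -expr2 sqr_ge0.
apply/colP => i; rewrite mxE; apply/eqP.
by have := u0 i (mem_index_enum i); rewrite mulf_eq0 orbb.
Qed.

Lemma enorm_ge0 u : 0 <= enorm u.
Proof. exact: sqrtr_ge0. Qed.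

Lemma sqr_enorm u : enorm u ^+ 2 = dot u u.
Proof. by rewrite sqr_sqrtr // dot_ge0. Qed.

(** The squared norm of [(v.v) u - (u.v) v] is [v.v] times the gap between the two sides. *)
Lemma dot_cauchy_schwarz u v : dot u v ^+ 2 <= dot u u * dot v v.
Proof.
have [->|v0] := eqVneq v 0.
  have e : dot u 0 = 0 by rewrite -(scale0r u) dotZr mul0r.
  by rewrite e expr0n mulr_ge0 ?dot_ge0.
have vv : 0 < dot v v by rewrite lt_neqAle dot_ge0 eq_sym dot_eq0 v0.
have := dot_ge0 (dot v v *: u - dot u v *: v).
rewrite !dot_bilin (dotC v u).
rewrite (_ : _ + _ = dot v v * (dot u u * dot v v - dot u v ^+ 2)); last by ring.
by rewrite pmulr_rge0 // subr_ge0.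
Qed.

Lemma dot_add_le u v : dot (u + v) (u + v) <= 2 * dot u u + 2 * dot v v.
Proof.
have := dot_ge0 (u - v); rewrite !dot_bilin (dotC v u); lra.
Qed.

Lemma sqr_coord_le u i : u i ord0 ^+ 2 <= dot u u.
Proof.
rewrite dotE (bigD1 i) //= -expr2 lerDl sumr_ge0 // => j _.
by rewrite -expr2 sqr_ge0.
Qed.

Lemma outer_mulmx s y u : s *m y^T *m u = dot y u *: s.
Proof.
by rewrite -mulmxA; apply/colP => i; rewrite !mxE big_ord1 mulrC; congr (_ * _).
Qed.

End Dot.

(** * Spectral bounds under BFGS updates *)

Section Bounds.
Context {R : realType} {n : nat}.
Implicit Types (u v w s y : 'cV[R]_n) (lam Lam eps M : R) (H : 'M[R]_n).

(** [Lam] bounds the square of the operator norm, so that only dot products occur. *)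
Definition spectral_bounds lam Lam H :=
  forall v, lam * dot v v <= dot v (H *m v) /\
            dot (H *m v) (H *m v) <= Lam * dot v v.

Lemma spectral_boundsW lam lam' Lam Lam' H : lam' <= lam -> Lam <= Lam' ->
  spectral_bounds lam Lam H -> spectral_bounds lam' Lam' H.
Proof.
move=> l1 l2 hH v; have [h1 h2] := hH v; have v0 := dot_ge0 v; split.
  by apply: le_trans h1; apply: ler_wpM2r.
by apply: le_trans h2 _; apply: ler_wpM2r.
Qed.

Lemma spectral_bounds_scalar a b c : 0 < a -> a <= c -> c <= b ->
  spectral_bounds a (b ^+ 2) (c%:M : 'M[R]_n).
Proof.
move=> a0 ac cb v; have v0 := dot_ge0 v.
rewrite mul_scalar_mx !dot_bilin mulrA -expr2; split; first exact: ler_wpM2r.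
apply: ler_wpM2r => //; rewrite ler_sqr ?nnegrE //; lra.
Qed.

Lemma acceptedP eps M s y : 0 < eps -> accepted eps M (s, y) ->
  [/\ 0 < dot y s, eps * dot s s <= dot y s & dot y y <= M * dot y s].
Proof.
rewrite /accepted !sqr_enorm => e0 /andP[h1 h2].
have ss : 0 < dot s s.
  rewrite lt_neqAle dot_ge0 andbT eq_sym; apply/eqP => s0.
  by move: h1; rewrite s0 invr0 mulr0; lra.
have h3 : eps * dot s s <= dot y s by rewrite -ler_pdivlMr.
have ys : 0 < dot y s by apply: lt_le_trans h3; rewrite mulr_gt0.
by split=> //; rewrite -ler_pdivrMr.
Qed.

(** The lower bound inverts the second test. For the upper one, Cauchy-Schwarz and the first test
    give [eps (y.s)^2 <= (y.y)(eps s.s) <= (y.y)(y.s)]; then cancel [y.s]. *)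
Lemma accepted_scaling_bounds eps M s y : 0 < eps -> 0 < M ->
  accepted eps M (s, y) ->
  M^-1 <= dot s y / enorm y ^+ 2 <= eps^-1.
Proof.
move=> e0 M0 /(acceptedP _ _ _ _ e0)[ys es yM]; rewrite sqr_enorm (dotC s y).
have cs := dot_cauchy_schwarz y s.
have yy : 0 < dot y y.
  rewrite lt_neqAle dot_ge0 andbT eq_sym; apply/eqP => y0.
  by move: cs; rewrite y0 mul0r; nra.
apply/andP; split; first by rewrite ler_pdivlMr // ler_pdivrMl.
rewrite ler_pdivrMr // ler_pdivlMl // -(ler_pM2r ys).
have := ler_wpM2l (ltW e0) cs; have := ler_wpM2l (ltW yy) es; lra.
Qed.

Lemma bfgs_update_mulmx H s y v : let rho := (dot y s)^-1 in
  let u := H *m (v - (rho * dot s v) *: y) in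
  bfgs_update H (s, y) *m v = u - (rho * dot y u) *: s + (rho * dot s v) *: s.
Proof.
rewrite /bfgs_update /=; set rho := _^-1; set u := H *m _.
rewrite [LHS]mulmxDl -2![X in X + _]mulmxA.
rewrite [(1%:M - rho *: (y *m s^T)) *m v]mulmxBl mul1mx.
rewrite -[(rho *: (y *m _)) *m v]scalemxAl outer_mulmx scalerA -/u.
by rewrite mulmxBl mul1mx -!scalemxAl !outer_mulmx !scalerA.
Qed.

(* Lower bound: with [w = v - rho (s.v) y], the new form is
   [w.(H w) + rho (s.v)^2], while [v = w + rho (s.v) y] gives
   [|v|^2 <= 2 |w|^2 + 2 M rho (s.v)^2]. *)
Lemma spectral_bounds_update eps M lam Lam H s y :
  0 < eps -> 0 < M -> 0 < lam -> 0 < Lam -> accepted eps M (s, y) ->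
  spectral_bounds lam Lam H ->
  spectral_bounds (Num.min lam M^-1 / 2)
    (2 * (2 + 2 * (M / eps)) ^+ 2 * Lam + 2 / eps ^+ 2) (bfgs_update H (s, y)).
Proof.
move=> e0 M0 l0 L0 /(acceptedP _ _ _ _ e0)[ys es yM] hH v.
rewrite bfgs_update_mulmx /=.
set rho := (dot y s)^-1; set w := v - _; set u := H *m w.
have r0 : 0 < rho by rewrite invr_gt0.
have rs : rho * dot s s <= eps^-1.
  by rewrite /rho ler_pdivrMl // ler_pdivlMr // mulrC.
have ry : rho * dot y y <= M.
  by rewrite /rho ler_pdivrMl // mulrC.
have [h1 h2] := hH w.
have vv := dot_ge0 v; have ww := dot_ge0 w.
have sS := dot_ge0 s; have yY := dot_ge0 y.
have K0 : 0 <= 2 + 2 * (M / eps) by rewrite addr_ge0 // mulr_ge0 // divr_ge0 // ltW.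
(* This bounds the squared norm of [rho s y^T]; with [dot_add_le], each factor [1 - rho s y^T] or
   its transpose costs at most [2 + 2 M / eps]. *)
have prod : rho ^+ 2 * dot s s * dot y y <= M / eps.
  rewrite (_ : _ * _ = (rho * dot y y) * (rho * dot s s)); last by ring.
  by apply: ler_pM => //; apply: mulr_ge0 => //; apply: ltW.
(* Stated for [a], [b] so as to cover both [1 - rho s y^T] and its transpose. *)
have proj (a b x : 'cV[R]_n) : dot a a * dot b b = dot s s * dot y y ->
    dot (x - (rho * dot b x) *: a) (x - (rho * dot b x) *: a)
      <= (2 + 2 * (M / eps)) * dot x x.
  move=> ab; apply: le_trans (dot_add_le _ _) _.
  rewrite !dot_bilin opprK [leRHS]mulrDl lerD2l -[leRHS]mulrA; apply: ler_wpM2l => //.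
  apply: (@le_trans _ _ (rho ^+ 2 * dot s s * dot y y * dot x x)); last first.
    by apply: ler_wpM2r => //; apply: dot_ge0.
  rewrite (_ : rho * _ * _ = rho ^+ 2 * dot a a * dot b x ^+ 2); last by ring.
  rewrite -[X in _ <= X * _]mulrA -ab [X in _ <= X * _]mulrA -[leRHS]mulrA; apply: ler_wpM2l.
    by rewrite mulr_ge0 ?sqr_ge0 ?dot_ge0.
  exact: dot_cauchy_schwarz.
(* Upper bound: the first summand passes through both projections and [H], giving [K^2 Lam]; the
   summand [rho (s.v) s] gives [(rho s.s)^2 <= eps^-2]. The factors 2 come from [dot_add_le]. *)
split; last first.
  apply: le_trans (dot_add_le _ _) _; rewrite [leRHS]mulrDl; apply: lerD.
    set K := 2 + _.
    rewrite (_ : 2 * _ * _ * _ = 2 * (K * (K * (Lam * dot v v)))); last by ring.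
    apply: ler_wpM2l => //; apply: le_trans (proj s y u erefl) _.
    apply: ler_wpM2l => //; apply: le_trans h2 _.
    rewrite [leRHS]mulrCA; apply: ler_wpM2l; first exact: ltW.
    by apply: proj; rewrite mulrC.
  rewrite -mulrA; apply: ler_wpM2l => //; rewrite !dot_bilin.
  rewrite (_ : rho * _ * _ = rho * (rho * dot s s) * dot s v ^+ 2); last by ring.
  apply: (@le_trans _ _ (rho * (rho * dot s s) * (dot s s * dot v v))).
    apply: ler_wpM2l; last exact: dot_cauchy_schwarz.
    by rewrite !mulr_ge0 // ltW.
  rewrite (_ : rho * _ * _ = (rho * dot s s) ^+ 2 * dot v v); last by ring.
  by apply: ler_wpM2r => //; rewrite -exprVn lerXn2r // nnegrE ?mulr_ge0 ?invr_ge0 // ltW.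
(* The minimum serves both terms, as [mu <= lam] and [mu M <= 1]; halving it absorbs the factor 2 in
   the bound on [v.v]. *)
set mu := Num.min _ _.
have mul : mu <= lam by rewrite /mu ge_min lexx.
have muM : mu * M <= 1.
  by rewrite -ler_pdivlMr // div1r /mu ge_min lexx orbT.
have mu0 : 0 < mu by rewrite /mu lt_min l0 invr_gt0.
set t := dot s v.
have vE : v = w + (rho * t) *: y by rewrite /w subrK.
have vvle : dot v v <= 2 * dot w w + 2 * M * (rho * t ^+ 2).
  rewrite {1 2}vE; apply: le_trans (dot_add_le _ _) _; rewrite lerD2l !dot_bilin.
  rewrite -mulrA; apply: ler_wpM2l => //.
  rewrite (_ : rho * t * _ = (rho * dot y y) * (rho * t ^+ 2)); last by ring.
  by apply: ler_wpM2r => //; rewrite mulr_ge0 ?sqr_ge0 // ltW.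
have quad : dot v (u - (rho * dot y u) *: s + (rho * t) *: s)
    = dot w u + rho * t ^+ 2.
  by rewrite /w !dot_bilin -/t (dotC v s) -/t; ring.
rewrite quad; set q := rho * t ^+ 2 in vvle *.
have q0 : 0 <= q by rewrite mulr_ge0 ?sqr_ge0 // ltW.
apply: (@le_trans _ _ (mu * dot w w + mu * M * q)).
  by rewrite -mulrA -mulrDr mulrAC -mulrA ler_pM2l //; lra.
apply: lerD; first by apply: le_trans h1; apply: ler_wpM2r.
by rewrite -[leRHS]mul1r; apply: ler_wpM2r.
Qed.

(** Induction on [m], splitting off the newest pair because [foldl] applies it last. The constants
    for [m.+1] come from one further update. *)
Lemma lbfgs_matrix_bounds eps M a b m : 0 < eps -> 0 < M -> 0 < a -> 0 < b ->
  exists lam Lam, [/\ 0 < lam, 0 < Lam &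
    forall (gamma : R) (B : seq (pair_of R n)), a <= gamma -> gamma <= b ->
      (size B <= m)%N -> all (accepted eps M) B ->
      spectral_bounds lam Lam (lbfgs_matrix gamma B)].
Proof.
move=> e0 M0 a0 b0; elim: m => [|m [lam [Lam [l0 L0 IH]]]].
  exists a, (b ^+ 2); split=> //; first by rewrite exprn_gt0.
  by move=> g [|//] ag gb _ _; apply: spectral_bounds_scalar.
have mu0 : 0 < Num.min lam M^-1 by rewrite lt_min l0 invr_gt0.
have mul : Num.min lam M^-1 <= lam by rewrite ge_min lexx.
have K2 : 2 <= 2 + 2 * (M / eps) by rewrite lerDl mulr_ge0 // divr_ge0 // ltW.
have eps2 : 0 < 2 / eps ^+ 2 by rewrite divr_gt0 // exprn_gt0.
have LL : Lam <= 2 * (2 + 2 * (M / eps)) ^+ 2 * Lam + 2 / eps ^+ 2.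
  apply: ler_wpDr; first exact: ltW.
  by rewrite ler_peMl ?(ltW L0) //; nra.
exists (Num.min lam M^-1 / 2), (2 * (2 + 2 * (M / eps)) ^+ 2 * Lam + 2 / eps ^+ 2).
split; [by rewrite divr_gt0 | exact: lt_le_trans LL |].
(* For the empty buffer, the new constants merely weaken the previous ones. *)
move=> g B ag gb; case/lastP: B => [_ _|B [s y]].
  apply: (spectral_boundsW _ _ _ _ _ _ LL (IH g [::] ag gb _ _)) => //; lra.
rewrite size_rcons all_rcons => sB /andP[acc aB].
rewrite /lbfgs_matrix foldl_rcons -/(lbfgs_matrix g B).
by apply: spectral_bounds_update => //; apply: IH.
Qed.

End Bounds.

(** * Lower bounds on bounded sets and telescoping decreases *)

Lemma trmx_continuous (R : realType) (m n : nat) :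
  continuous (trmx : 'M[R]_(m, n) -> 'M[R]_(n, m)).
Proof.
move=> v A /nbhs_ballP[e e0 eA]; apply/nbhs_ballP; exists e => // x [_ vx].
by apply: eA; split=> // i j; rewrite !mxE; exact: vx.
Qed.

(** [A] lies in a box [[-C, C]^n], on which [f] attains a minimum; transposition carries this over
    from row vectors, where [rV_compact] applies. *)
Lemma continuous_ebounded_lb {R : realType} {n : nat} (f : 'cV[R]_n -> R)
    (A : set 'cV[R]_n) : continuous f -> ebounded A ->
  exists L, forall x, A x -> L <= f x.
Proof.
move=> fc [C AC].
pose K := [set v : 'rV[R]_n | forall i, `[- C, C]%classic (v ord0 i)].
have cK : compact K.
  by apply: (@rV_compact _ _ (fun=> `[- C, C]%classic)) => _; apply: segment_compact.
have AK x : A x -> K x^T.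
  move=> Ax i /=; rewrite mxE in_itv /= -ler_norml -sqrtr_sqr.
  apply: le_trans (AC _ Ax); rewrite ler_sqrt ?dot_ge0 //; exact: sqr_coord_le.
have [->|/set0P[x1 Ax1]] := eqVneq A set0; first by exists 0.
have ctr : {within K, continuous (fun v => f v^T)}.
  apply: continuous_subspaceT => v.
  by apply: continuous_comp; [exact: trmx_continuous | exact: fc].
have [|c _ cmin] := compact_EVT_min _ cK ctr; first by exists x1^T; apply: AK.
exists (f c^T) => x /AK/mem_set/cmin; by rewrite trmxK.
Qed.

(** [u] decreases and is bounded below, so its successive differences vanish in the limit and
    squeeze [g]. *)
Lemma cvg0_of_telescoping_bound {R : realType} (c L : R) (u g : nat -> R) : 0 < c ->
  (forall k, 0 <= g k) -> (forall k, L <= u k) ->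
  (forall k, u k.+1 <= u k - c * g k) -> g @ \oo --> (0 : R).
Proof.
move=> c0 g0 uL ug.
have cu : cvgn u.
  apply: nonincreasing_is_cvgn.
    apply/nonincreasing_seqP => k; apply: le_trans (ug k) _.
    by rewrite gerBl mulr_ge0 // ltW.
  by exists L => _ [k _ <-].
have d0 : (fun k => c^-1 * (u k - u k.+1)) @ \oo --> (0 : R).
  rewrite -(mulr0 c^-1) -(subrr (limn u)).
  by apply: cvgMr; apply: cvgB => //; rewrite (cvg_shiftS u).
apply: squeeze_cvgr d0; last exact: cvg_cst.
apply: nearW => k; rewrite g0 ler_pdivlMl //=.
by have := ug k; lra.
Qed.

(** * Invariants of the buffer and of the scaling *)

Lemma push_all {T : Type} (P : pred T) m (B : seq T) a :
  all P B -> P a -> all P (push m B a).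
Proof.
move=> PB Pa; rewrite /push all_rcons Pa /=; case: ifP => // _.
by case: B PB => //= b B /andP[].
Qed.

(** In a full buffer [behead] frees the place taken by the new pair, as [m >= 1] makes it
    nonempty. *)
Lemma size_push {T : Type} m (B : seq T) a :
  (1 <= m)%N -> (size B <= m)%N -> (size (push m B a) <= m)%N.
Proof.
move=> m1 Bm; rewrite /push size_rcons; case: eqP => [e|/eqP e].
  by rewrite size_behead e prednK.
by rewrite ltn_neqAle e.
Qed.

Section Run.
Context {R : realType} {n : nat} {f : 'cV[R]_n -> R} {m : nat}.
Context {eps M c1 c2 : R} {x0 : 'cV[R]_n}.
Context {x : nat -> 'cV[R]_n} {alpha gamma : nat -> R}.
Context {B : nat -> seq (pair_of R n)}.
Hypotheses (m_gt0 : (1 <= m)%N) (eps_gt0 : 0 < eps) (M_gt0 : 0 < M).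
Hypothesis run : two_sided_lbfgs f x0 m eps M c1 c2 x alpha gamma B.

Lemma run_buffer k : (size (B k) <= m)%N /\ all (accepted eps M) (B k).
Proof.
elim: k => [|k [sB aB]]; first by rewrite (lbfgs_B0 run).
rewrite (lbfgs_BS run); case: ifP => // acc.
by split; [exact: size_push | exact: push_all].
Qed.

(** The 1 in both bounds accounts for the initial scaling, kept until a pair is accepted. *)
Lemma run_gamma k : Num.min 1 M^-1 <= gamma k <= Num.max 1 eps^-1.
Proof.
elim: k => [|k IH]; first by rewrite (lbfgs_gamma0 run) ge_min le_max lexx.
rewrite (lbfgs_gammaS run); case: ifP => // /(accepted_scaling_bounds _ _ _ _ eps_gt0 M_gt0)/andP[h1 h2].
by rewrite ge_min le_max h1 h2 !orbT.
Qed.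

Lemma run_matrix_bounds : exists lam Lam, [/\ 0 < lam, 0 < Lam &
  forall k, spectral_bounds lam Lam (lbfgs_matrix (gamma k) (B k))].
Proof.
have [||lam [Lam [l0 L0 h]]] := @lbfgs_matrix_bounds R n eps M (Num.min 1 M^-1)
    (Num.max 1 eps^-1) m eps_gt0 M_gt0.
- by rewrite lt_min ltr01 invr_gt0.
- by rewrite lt_max ltr01.
exists lam, Lam; split=> // k; have [sB aB] := run_buffer k.
by have /andP[g1 g2] := run_gamma k; apply: h.
Qed.

End Run.

(** * Step lengths, sufficient decrease and the limit *)

Theorem theorem9 (R : realType) (n : nat) (f : 'cV[R]_n -> R)
    (m : nat) (eps M c1 c2 : R) (x0 : 'cV[R]_n)
    (x : nat -> 'cV[R]_n) (alpha gamma : nat -> R)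
    (B : nat -> seq (pair_of R n)) (beta : R) :
  C1 f ->
  (1 <= m)%N ->
  0 < eps -> 0 < M ->
  0 < c1 -> c1 < c2 -> c2 < 1 ->
  two_sided_lbfgs f x0 m eps M c1 c2 x alpha gamma B ->
  ebounded (level_set f x0) ->
  0 < beta ->
  elipschitz_on (level_set f x0) beta (grad f) ->
  (fun k => enorm (grad f (x k))) @ \oo --> (0 : R).
Proof.
move=> [fd _] m1 e0 M0 c1_gt0 c12 c2_lt1 run bnd beta0 lip.
have [lam [Lam [l0 L0 hH]]] := run_matrix_bounds m1 e0 M0 run.
have fc : continuous f by move=> z; exact/differentiable_continuous/fd.
have [L fL] := continuous_ebounded_lb _ _ fc bnd.
pose g k := grad f (x k).
pose p k := search_dir f (x k) (gamma k) (B k).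
have gg k : 0 < dot (g k) (g k).
  rewrite lt_neqAle dot_ge0 andbT eq_sym dot_eq0.
  by apply/eqP; exact: (lbfgs_grad_neq0 run).
have descent k : lam * dot (g k) (g k) <= - dot (g k) (p k).
  by have [h _] := hH k (g k); rewrite /p /search_dir dotNr opprK.
have pbound k : dot (p k) (p k) <= Lam * dot (g k) (g k).
  by have [_ h] := hH k (g k); rewrite /p /search_dir dotNl dotNr opprK.
have a0 := lbfgs_alpha_gt0 run.
have xS k : x k.+1 = x k + alpha k *: p k := lbfgs_xS run k.
have armijo k : f (x k.+1) <= f (x k) - c1 * alpha k * (lam * dot (g k) (g k)).
  have [h _] := lbfgs_wolfe run k; rewrite xS; apply: le_trans h _.
  rewrite lerD2l -/(p k) -/(g k) lerNr -mulrN.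
  by rewrite ler_pM2l ?mulr_gt0 // descent.
(* The Lipschitz bound holds only on the level set, which the decrease of [f] keeps the iterates
   in. *)
have xO k : level_set f x0 (x k).
  elim: k => [|k IH]; first by rewrite /level_set /= (lbfgs_x0 run).
  apply: le_trans IH; apply: le_trans (armijo k) _.
  by rewrite gerBl !mulr_ge0 ?dot_ge0 // ltW.
(* Obtained by cancelling [|g|^2] in [(1 - c2) lam |g|^2 <= y.p <= beta alpha |p|^2 <= beta alpha
   Lam |g|^2]. *)
pose abar := (1 - c2) * lam / (beta * Lam).
have abar0 : 0 < abar by rewrite divr_gt0 ?mulr_gt0 // subr_gt0.
have step k : abar <= alpha k.
  have := lip _ _ (xO k.+1) (xO k); rewrite -/(g k) -/(g k.+1).
  set y := g k.+1 - g k.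
  have -> : x k.+1 - x k = alpha k *: p k by rewrite xS addrC addKr.
  move=> lipk.
  have pp := dot_ge0 (p k).
  have yy : dot y y <= (beta * alpha k) ^+ 2 * dot (p k) (p k).
    have : enorm y ^+ 2 <= (beta * enorm (alpha k *: p k)) ^+ 2.
      by rewrite ler_sqr // nnegrE ?mulr_ge0 ?enorm_ge0 // ltW.
    by rewrite exprMn !sqr_enorm !dot_bilin; lra.
  have yp : dot y (p k) <= beta * alpha k * dot (p k) (p k).
    have ba : 0 < beta * alpha k by rewrite mulr_gt0.
    have rhs0 : 0 <= beta * alpha k * dot (p k) (p k) by rewrite mulr_ge0 // ltW.
    apply: le_trans (ler_norm _) _.
    rewrite -ler_sqr ?nnegrE // real_normK ?num_real //.
    apply: le_trans (dot_cauchy_schwarz _ _) _.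
    by rewrite exprMn [_ (p k) ^+ 2]expr2 mulrA; apply: ler_wpM2r.
  have D0 : 0 < - dot (g k) (p k).
    by apply: lt_le_trans (descent k); rewrite mulr_gt0.
  (* As [g.p < 0], the curvature condition gives [c2 (g.p) <= g'.p] for the new gradient [g'];
     subtract [g.p]. *)
  have curv : (1 - c2) * - dot (g k) (p k) <= dot y (p k).
    have h : `|dot (g k.+1) (p k)| <= c2 * `|dot (g k) (p k)|.
      by have [_] := lbfgs_wolfe run k; rewrite -/(p k) -xS.
    move: h; rewrite [X in _ <= _ * X]ltr0_norm -?oppr_gt0 // ler_norml => /andP[h _].
    by rewrite /y dotDl dotNl; lra.
  rewrite ler_pdivrMr ?mulr_gt0 // -(ler_pM2r (gg k)).
  apply: (@le_trans _ _ ((1 - c2) * - dot (g k) (p k))).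
    by rewrite -mulrA ler_pM2l ?subr_gt0.
  apply: le_trans curv (le_trans yp _).
  rewrite (_ : alpha k * _ * _ = beta * alpha k * (Lam * dot (g k) (g k))); last by ring.
  by rewrite ler_pM2l // mulr_gt0.
have g2 : (fun k => dot (g k) (g k)) @ \oo --> (0 : R).
  apply: (@cvg0_of_telescoping_bound _ (c1 * abar * lam) L (f \o x)).
  - by apply: mulr_gt0 => //; apply: mulr_gt0.
  - by move=> k; apply: dot_ge0.
  - by move=> k; exact: fL (xO k).
  move=> k /=; apply: le_trans (armijo k) _; rewrite lerD2l lerN2.
  rewrite -[leLHS]mulrA; apply: ler_wpM2r.
    by rewrite mulr_ge0 ?dot_ge0 // ltW.
  by rewrite ler_pM2l.
(* [enorm] is the square root of [dot], so continuity of the root at 0 transfers the limit. *)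
rewrite -(@sqrtr0 R).
exact: (continuous_cvg _ (@sqrt_continuous R 0) g2).
Qed.
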